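(* Let $\mathfrak M^{\Rightarrow_{A1}}=\langle\mathbf{PP}_6^{\Rightarrow_{A1}},{\uparrow}\mathbf b\rangle$ and let $\mathsf R$ be the Set-Set calculus consisting of the rules $\mathsf r_1$–$\mathsf r_{37}$ together with the three rules $\frac{q}{p\Rightarrow q}$, $\frac{\ }{p,\ p\Rightarrow q}$, $\frac{p,\ p\Rightarrow q}{q}$. Then $\mathsf R$ is $\{p,{\sim}p,\circ p\}$-analytic and $\rhd_{\mathsf R}$ coincides with the Set-Set logic determined by $\mathfrak M^{\Rightarrow_{A1}}$.
   Context: Let $\mathcal{V}_6=\{\hat{\mathbf f},\mathbf f,\mathbf n,\mathbf b,\mathbf t,\hat{\mathbf t}\}$, partially ordered as a bounded distributive lattice by $\hat{\mathbf f}<\mathbf f<\mathbf n<\mathbf t<\hat{\mathbf t}$ and $\mathbf f<\mathbf b<\mathbf t$, with $\mathbf n,\mathbf b$ incomparable. $\mathbf{PP}_6$ is the algebra on $\mathcal V_6$ in the signature $\{\land,\lor,{\sim},\circ,\bot,\top\}$ where $\land,\lor$ are meet and join, $\bot=\hat{\mathbf f}$, $\top=\hat{\mathbf t}$, ${\sim}$ swaps $\mathbf f\leftrightarrow\mathbf t$ and $\hat{\mathbf f}\leftrightarrow\hat{\mathbf t}$ and fixes $\mathbf n,\mathbf b$, and ${\circ}a=\hat{\mathbf t}$ if $a\in\{\hat{\mathbf f},\hat{\mathbf t}\}$, ${\circ}a=\hat{\mathbf f}$ otherwise. ${\uparrow}\mathbf b=\{\mathbf b,\mathbf t,\hat{\mathbf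 t}\}$. $\mathbf{PP}_6^{\Rightarrow_{A1}}$ is the multialgebra expanding $\mathbf{PP}_6$ with the binary multioperation $a\Rightarrow_{A1}b={\uparrow}\mathbf b$ if $a\notin{\uparrow}\mathbf b$ or $b\in{\uparrow}\mathbf b$, and $a\Rightarrow_{A1}b=\mathcal V_6\setminus{\uparrow}\mathbf b$ otherwise. Semantics: formulas are built from a countably infinite set of variables (including $p,q$). A valuation on a PNmatrix $\langle\mathbf A,D\rangle$ (multialgebra plus designated set) is a map $h$ with $h(\copyright(\varphi_1,\dots,\varphi_k))\in\copyright^{\mathbf A}(h(\varphi_1),\dots,h(\varphi_k))$; its Set-Set logic: $\Phi\rhd\Psi$ iff every valuation $h$ has $h(\varphi)\notin D$ for some $\varphi\in\Phi$ or $h(\psi)\in D$ for some $\psi\in\Psi$. Set-Set calculi: a rule $\frac{\Pi}{\Theta}$ is a pair of sets of formulas. For a calculus $\mathsf R$, a derivation is a finite rooted tree whose nodes are labelled by sets of formulas or by $\ast$, such that each non-leaf node labelled $\Gamma$ is expanded by a rule $\frac{\Pi}{\Theta}\in\mathsf R$ and a substitution $\sigma$ with $\sigma(\Pi)\subseteq\Gamma$: its children are nodes labelled $\Gamma\cup\{\theta\}$, one for each $\theta\in\sigma(\Theta)$, if $\Theta\ne\varnothing$, or a single node labelled $\ast$ if $\Theta=\varnothing$. $\Phi\rhd_{\mathsf R}\Psi$ iff there is a derivation whose root label is contained in $\Phi$ and each leaf is labelled $\ast$ or by a set meeting $\Psi$. For $\Lambda$ a set of formulas, $\Phi\rhd^{\Lambda}_{\mathsf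 R}\Psi$ means there is such a derivation using only formulas in $\Lambda$. Given a set $\Xi$ of formulas, for a set $\Gamma$ let $\Upsilon^{\Xi}(\Gamma)$ be the set of subformulas of $\Gamma$ together with all $\sigma(\varphi)$ for $\varphi\in\Xi$ and $\sigma$ a substitution mapping variables to subformulas of $\Gamma$. $\mathsf R$ is $\Xi$-analytic if $\Phi\rhd_{\mathsf R}\Psi$ implies $\Phi\rhd^{\Upsilon^\Xi(\Phi\cup\Psi)}_{\mathsf R}\Psi$. The rules (antecedent/succedent; blank means empty): $\mathsf r_1$: $\frac{}{\top}$; $\mathsf r_2$: $\frac{{\sim}\top}{}$; $\mathsf r_3$: $\frac{}{{\sim}\bot}$; $\mathsf r_4$: $\frac{\bot}{}$; $\mathsf r_5$: $\frac{p}{{\sim}{\sim}p}$; $\mathsf r_6$: $\frac{{\sim}{\sim}p}{p}$; $\mathsf r_7$: $\frac{p\land q}{p}$; $\mathsf r_8$: $\frac{p\land q}{q}$; $\mathsf r_9$: $\frac{p,q}{p\land q}$; $\mathsf r_{10}$: $\frac{{\sim}p}{{\sim}(p\land q)}$; $\mathsf r_{11}$: $\frac{{\sim}q}{{\sim}(p\land q)}$; $\mathsf r_{12}$: $\frac{{\sim}(p\land q)}{{\sim}p,{\sim}q}$; $\mathsf r_{13}$: $\frac{p}{p\lor q}$; $\mathsf r_{14}$: $\frac{q}{p\lor q}$; $\mathsf r_{15}$: $\frac{p\lor q}{p,q}$; $\mathsf r_{16}$: $\frac{{\sim}p,{\sim}q}{{\sim}(p\lor q)}$; $\mathsf r_{17}$: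 $\frac{{\sim}(p\lor q)}{{\sim}p}$; $\mathsf r_{18}$: $\frac{{\sim}(p\lor q)}{{\sim}q}$; $\mathsf r_{19}$: $\frac{}{\circ\bot}$; $\mathsf r_{20}$: $\frac{}{\circ\top}$; $\mathsf r_{21}$: $\frac{}{\circ\circ p}$; $\mathsf r_{22}$: $\frac{\circ p}{\circ{\sim}p}$; $\mathsf r_{23}$: $\frac{\circ{\sim}p}{\circ p}$; $\mathsf r_{24}$: $\frac{\circ p}{p,{\sim}p}$; $\mathsf r_{25}$: $\frac{\circ p,p,{\sim}p}{}$; $\mathsf r_{26}$: $\frac{\circ p}{\circ(p\land q),p}$; $\mathsf r_{27}$: $\frac{\circ q}{\circ(p\land q),q}$; $\mathsf r_{28}$: $\frac{\circ(p\land q),q}{\circ p}$; $\mathsf r_{29}$: $\frac{\circ(p\land q),p}{\circ q}$; $\mathsf r_{30}$: $\frac{\circ p,\circ q}{\circ(p\land q)}$; $\mathsf r_{31}$: $\frac{\circ(p\land q)}{\circ p,\circ q}$; $\mathsf r_{32}$: $\frac{\circ p,\circ q}{\circ(p\lor q)}$; $\mathsf r_{33}$: $\frac{\circ(p\lor q)}{\circ p,\circ q}$; $\mathsf r_{34}$: $\frac{\circ p,p}{\circ(p\lor q)}$; $\mathsf r_{35}$: $\frac{\circ q,q}{\circ(p\lor q)}$; $\mathsf r_{36}$: $\frac{\circ(p\lor q)}{\circ p,q}$; $\mathsf r_{37}$: $\frac{\circ(p\lor q)}{\circ q,p}$. *)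

(* Defs.v *)
From Stdlib Require List.
From HB Require Import structures.
From mathcomp Require Import all_boot all_order.
From mathcomp Require Import mathcomp_extra boolp classical_sets.
Set Implicit Arguments.
Unset Strict Implicit.
Unset Printing Implicit Defensive.
Import Order.TTheory.

Local Open Scope classical_set_scope.

Inductive fm : Type :=
| Var of nat
| Bot
| Top
| Neg of fm
| Circ of fm
| And of fm & fm
| Or of fm & fm
| Imp of fm & fm.

Declare Scope fm_scope.
Delimit Scope fm_scope with fm.
Bind Scope fm_scope with fm.
Notation "∼ A" := (Neg A) (at level 75, right associativity) : fm_scope.
Notation "∘ A" := (Circ A) (at level 75, right associativity) : fm_scope.
Notation "A ∧ B" := (And A B) (at level 80, right associativity) : fm_scope.
Notation "A ∨ B" := (Or A B) (at level 85, right associativity) : fm_scope.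
Notation "A ⇒ B" := (Imp A B) (at level 90, right associativity) : fm_scope.

Fixpoint fm_encode (A : fm) : GenTree.tree nat :=
  match A with
  | Var n => GenTree.Leaf n
  | Bot => GenTree.Node 0 [::]
  | Top => GenTree.Node 1 [::]
  | Neg A => GenTree.Node 2 [:: fm_encode A]
  | Circ A => GenTree.Node 3 [:: fm_encode A]
  | And A B => GenTree.Node 4 [:: fm_encode A; fm_encode B]
  | Or A B => GenTree.Node 5 [:: fm_encode A; fm_encode B]
  | Imp A B => GenTree.Node 6 [:: fm_encode A; fm_encode B]
  end.

Fixpoint fm_decode (t : GenTree.tree nat) : fm :=
  match t with
  | GenTree.Leaf n => Var n
  | GenTree.Node 1 [::] => Top
  | GenTree.Node 2 [:: a] => Neg (fm_decode a)
  | GenTree.Node 3 [:: a] => Circ (fm_decode a)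
  | GenTree.Node 4 [:: a; b] => And (fm_decode a) (fm_decode b)
  | GenTree.Node 5 [:: a; b] => Or (fm_decode a) (fm_decode b)
  | GenTree.Node 6 [:: a; b] => Imp (fm_decode a) (fm_decode b)
  | _ => Bot
  end.

Lemma fm_encodeK : cancel fm_encode fm_decode.
Proof. by elim=> //= [A ->|A ->|A -> B ->|A -> B ->|A -> B ->]. Qed.

HB.instance Definition _ := Countable.copy fm (can_type fm_encodeK).

Fixpoint fsubst (s : nat -> fm) (A : fm) : fm :=
  match A with
  | Var n => s n
  | Bot => Bot
  | Top => Top
  | Neg A => Neg (fsubst s A)
  | Circ A => Circ (fsubst s A)
  | And A B => And (fsubst s A) (fsubst s B)
  | Or A B => Or (fsubst s A) (fsubst s B)
  | Imp A B => Imp (fsubst s A) (fsubst s B)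
  end.

Fixpoint subformulas (A : fm) : seq fm :=
  A :: match A with
       | Var _ | Bot | Top => [::]
       | Neg B | Circ B => subformulas B
       | And B C | Or B C | Imp B C => subformulas B ++ subformulas C
       end.

Definition sub (G : set fm) : set fm :=
  [set B | exists2 A, G A & B \in subformulas A].

(* The multioperations may take the empty set as a value. *)
Record multialgebra : Type := Multialgebra {
  carrier :> Type;
  m_bot : set carrier;
  m_top : set carrier;
  m_neg : carrier -> set carrier;
  m_circ : carrier -> set carrier;
  m_and : carrier -> carrier -> set carrier;
  m_or : carrier -> carrier -> set carrier;
  m_imp : carrier -> carrier -> set carrier
}.

Record pnmatrix : Type := PNmatrix {
  alg :> multialgebra;
  designated : set alg
}.

Definition valuation (M : pnmatrix) (h : fm -> M) : Prop :=
  m_bot (h Bot) /\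
  m_top (h Top) /\
  (forall A, m_neg (h A) (h (Neg A))) /\
  (forall A, m_circ (h A) (h (Circ A))) /\
  (forall A B, m_and (h A) (h B) (h (And A B))) /\
  (forall A B, m_or (h A) (h B) (h (Or A B))) /\
  (forall A B, m_imp (h A) (h B) (h (Imp A B))).

Definition entails (M : pnmatrix) (Phi Psi : set fm) : Prop :=
  forall h : fm -> M, valuation h ->
    (exists2 A, Phi A & ~ designated (h A)) \/
    (exists2 B, Psi B & designated (h B)).

Record rule : Type := Rule { prem : set fm; concl : set fm }.

Definition calculus := set rule.

(* [None] stands for the label [*]. *)
Definition label := option (set fm).

Inductive dtree : Type := Node of label & seq dtree.

Definition root_label (t : dtree) : label := let: Node l _ := t in l.

Fixpoint labels (t : dtree) : seq label :=
  let: Node l cs := t in l :: flatten (map labels cs).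

Fixpoint leaf_labels (t : dtree) : seq label :=
  let: Node l cs := t in
  if cs is [::] then [:: l] else flatten (map leaf_labels cs).

(* In the last constructor [e] lists the instantiated succedent without
   repetition, so the node has exactly one child for each of its elements; in
   particular that set has to be finite. *)
Inductive derivation (R : calculus) : dtree -> Prop :=
| deriv_leaf (l : label) : derivation R (Node l [::])
| deriv_star (G : set fm) (r : rule) (s : nat -> fm) :
    R r -> fsubst s @` prem r `<=` G -> concl r = set0 ->
    derivation R (Node (Some G) [:: Node None [::]])
| deriv_expand (G : set fm) (r : rule) (s : nat -> fm)
    (e : seq fm) (cs : seq dtree) :
    R r -> fsubst s @` prem r `<=` G -> concl r !=set0 ->
    uniq e -> [set` e] = fsubst s @` concl r ->
    map root_label cs = [seq Some (G `|` [set A]) | A <- e] ->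
    (forall c, List.In c cs -> derivation R c) ->
    derivation R (Node (Some G) cs).

Definition proves (R : calculus) (Phi Psi : set fm) (t : dtree) : Prop :=
  [/\ derivation R t,
      exists2 G, root_label t = Some G & G `<=` Phi &
      forall G, List.In (Some G) (leaf_labels t) -> G `&` Psi !=set0].

Definition derives (R : calculus) (Phi Psi : set fm) : Prop :=
  exists t, proves R Phi Psi t.

Definition derives_in (L : set fm) (R : calculus) (Phi Psi : set fm) : Prop :=
  exists2 t, proves R Phi Psi t &
    forall G, List.In (Some G) (labels t) -> G `<=` L.

Definition Upsilon (Xi G : set fm) : set fm :=
  sub G `|` [set A | exists s : nat -> fm, exists2 B,
                       (forall n, sub G (s n)) /\ Xi B & A = fsubst s B].

Definition analytic (Xi : set fm) (R : calculus) : Prop :=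
  forall Phi Psi : set fm,
    derives R Phi Psi -> derives_in (Upsilon Xi (Phi `|` Psi)) R Phi Psi.

Inductive V6 : Type := v_fhat | v_f | v_n | v_b | v_t | v_that.

Definition V6_encode (x : V6) : nat :=
  match x with
  | v_fhat => 0 | v_f => 1 | v_n => 2 | v_b => 3 | v_t => 4 | v_that => 5
  end.

Definition V6_decode (n : nat) : V6 :=
  match n with
  | 0 => v_fhat | 1 => v_f | 2 => v_n | 3 => v_b | 4 => v_t | _ => v_that
  end.

Lemma V6_encodeK : cancel V6_encode V6_decode. Proof. by case. Qed.

HB.instance Definition _ := Countable.copy V6 (can_type V6_encodeK).

Lemma V6_enumP : Finite.axiom [:: v_fhat; v_f; v_n; v_b; v_t; v_that].
Proof. by case. Qed.

HB.instance Definition _ := isFinite.Build V6 V6_enumP.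

Definition V6_le : rel V6 := fun x y =>
  [|| x == y, x == v_fhat, y == v_that,
      (x == v_f) && (y != v_fhat) | (y == v_t) && (x != v_that)].

Definition V6_lt : rel V6 := fun x y => (y != x) && V6_le x y.

Definition V6_meet (x y : V6) : V6 :=
  if V6_le x y then x else if V6_le y x then y else v_f.

Definition V6_join (x y : V6) : V6 :=
  if V6_le x y then y else if V6_le y x then x else v_t.

Lemma V6_le_def x y : V6_le x y = (V6_meet x y == x).
Proof. by case: x; case: y. Qed.

Lemma V6_lt_def x y : V6_lt x y = (y != x) && V6_le x y.
Proof. by []. Qed.

Lemma V6_meetC : commutative V6_meet. Proof. by do 2 case. Qed.

Lemma V6_joinC : commutative V6_join. Proof. by do 2 case. Qed.

Lemma V6_meetA : associative V6_meet. Proof. by do 3 case. Qed.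

Lemma V6_joinA : associative V6_join. Proof. by do 3 case. Qed.

Lemma V6_joinKI y x : V6_meet x (V6_join x y) = x.
Proof. by case: x; case: y. Qed.

Lemma V6_meetKU y x : V6_join x (V6_meet x y) = x.
Proof. by case: x; case: y. Qed.

Lemma V6_meetUl : left_distributive V6_meet V6_join.
Proof. by do 3 case. Qed.

Lemma V6_meetxx : idempotent_op V6_meet. Proof. by case. Qed.

Fact V6_display : Order.disp_t.
Proof. exact: Order.Disp tt tt. Qed.

HB.instance Definition _ := Order.isMeetJoinDistrLattice.Build V6_display V6
  V6_le_def V6_lt_def V6_meetC V6_joinC V6_meetA V6_joinA V6_joinKI V6_meetKU
  V6_meetUl V6_meetxx.

Lemma V6_le0x (x : V6) : (v_fhat <= x)%O. Proof. by case: x. Qed.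

Lemma V6_lex1 (x : V6) : (x <= v_that)%O. Proof. by case: x. Qed.

HB.instance Definition _ := Order.hasBottom.Build V6_display V6 V6_le0x.
HB.instance Definition _ := Order.hasTop.Build V6_display V6 V6_lex1.

Definition V6_neg (x : V6) : V6 :=
  match x with
  | v_fhat => v_that
  | v_f => v_t
  | v_n => v_n
  | v_b => v_b
  | v_t => v_f
  | v_that => v_fhat
  end.

Definition V6_circ (x : V6) : V6 :=
  if x \in [:: v_fhat; v_that] then v_that else v_fhat.

Definition up_b : set V6 := [set x | (v_b <= x)%O].

Definition V6_imp_A1 (x y : V6) : set V6 :=
  if (~~ (v_b <= x) || (v_b <= y))%O then up_b else ~` up_b.

Definition PP6_A1 : multialgebra := {|
  carrier := V6;
  m_bot := [set Order.bottom];
  m_top := [set Order.top];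
  m_neg := fun x => [set V6_neg x];
  m_circ := fun x => [set V6_circ x];
  m_and := fun x y => [set Order.meet x y];
  m_or := fun x y => [set Order.join x y];
  m_imp := V6_imp_A1
|}.

Definition M_A1 : pnmatrix := @PNmatrix PP6_A1 up_b.

Definition p : fm := Var 0.
Definition q : fm := Var 1.

Definition PP6_rules : seq (seq fm * seq fm) := [::
  ([::], [:: Top]);
  ([:: ∼ Top], [::]);
  ([::], [:: ∼ Bot]);
  ([:: Bot], [::]);
  ([:: p], [:: ∼ ∼ p]);
  ([:: ∼ ∼ p], [:: p]);
  ([:: p ∧ q], [:: p]);
  ([:: p ∧ q], [:: q]);
  ([:: p; q], [:: p ∧ q]);
  ([:: ∼ p], [:: ∼ (p ∧ q)]);
  ([:: ∼ q], [:: ∼ (p ∧ q)]);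
  ([:: ∼ (p ∧ q)], [:: ∼ p; ∼ q]);
  ([:: p], [:: p ∨ q]);
  ([:: q], [:: p ∨ q]);
  ([:: p ∨ q], [:: p; q]);
  ([:: ∼ p; ∼ q], [:: ∼ (p ∨ q)]);
  ([:: ∼ (p ∨ q)], [:: ∼ p]);
  ([:: ∼ (p ∨ q)], [:: ∼ q]);
  ([::], [:: ∘ Bot]);
  ([::], [:: ∘ Top]);
  ([::], [:: ∘ ∘ p]);
  ([:: ∘ p], [:: ∘ ∼ p]);
  ([:: ∘ ∼ p], [:: ∘ p]);
  ([:: ∘ p], [:: p; ∼ p]);
  ([:: ∘ p; p; ∼ p], [::]);
  ([:: ∘ p], [:: ∘ (p ∧ q); p]);
  ([:: ∘ q], [:: ∘ (p ∧ q); q]);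
  ([:: ∘ (p ∧ q); q], [:: ∘ p]);
  ([:: ∘ (p ∧ q); p], [:: ∘ q]);
  ([:: ∘ p; ∘ q], [:: ∘ (p ∧ q)]);
  ([:: ∘ (p ∧ q)], [:: ∘ p; ∘ q]);
  ([:: ∘ p; ∘ q], [:: ∘ (p ∨ q)]);
  ([:: ∘ (p ∨ q)], [:: ∘ p; ∘ q]);
  ([:: ∘ p; p], [:: ∘ (p ∨ q)]);
  ([:: ∘ q; q], [:: ∘ (p ∨ q)]);
  ([:: ∘ (p ∨ q)], [:: ∘ p; q]);
  ([:: ∘ (p ∨ q)], [:: ∘ q; p])
]%fm.

Definition imp_A1_rules : seq (seq fm * seq fm) := [::
  ([:: q], [:: p ⇒ q]);
  ([::], [:: p; p ⇒ q]);
  ([:: p; p ⇒ q], [:: q])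
]%fm.

Definition R_A1 : calculus :=
  [set Rule [set` x.1] [set` x.2] | x in [set` PP6_rules ++ imp_A1_rules]].

Definition Xi_A1 : set fm := [set` [:: p; ∼ p; ∘ p]%fm].

(* Main.v *)
(** Soundness is a truth-table check of the 40 rules.  For completeness with
    the analyticity bound, let [L] be the set of subformulas of
    [Phi `|` Psi] together with their images under [∼] and [∘].  If
    [Psi] is not [L]-derivable from [Phi], a Lindenbaum extension yields
    [Om `<=` L] containing [Phi], disjoint from [Psi] and closed under every
    rule instance with succedent in [L].  For a subformula [A] the three bits
    [A \in Om], [∼ A \in Om], [∘ A \in Om] determine a value in
    [V6]: rules 24 and 25 exclude the two remaining combinations, and the other
    rules make this assignment a partial valuation, which extends to all formulas
    because the set of subformulas is closed under subformulas. *)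
Require Import Defs.
From mathcomp Require Import all_boot all_order.
From mathcomp Require Import mathcomp_extra boolp classical_sets.

Set Implicit Arguments.
Unset Strict Implicit.
Unset Printing Implicit Defensive.

Local Open Scope classical_set_scope.

(** [R_A1] unfolds to [calculus_of (PP6_rules ++ imp_A1_rules)], so results on finitary calculi
    apply to it by conversion. *)
Definition calculus_of (rs : seq (seq fm * seq fm)) : calculus :=
  [set Rule [set` x.1] [set` x.2] | x in [set` rs]].

(** * Closing a set of formulas *)

Section Closes.
Variables (rs : seq (seq fm * seq fm)) (L Psi : set fm).

(* An expansion by a rule with empty succedent has no branch to close, so it
   covers the label [*] as well. *)
Inductive closes : set fm -> Prop :=
| closes_goal (G : set fm) (A : fm) : G A -> Psi A -> closes G
| closes_rule (G : set fm) (x : seq fm * seq fm) (s : nat -> fm) :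
    x \in rs -> (forall A, A \in x.1 -> G (fsubst s A)) ->
    (forall A, A \in x.2 -> L (fsubst s A)) ->
    (forall A, A \in x.2 -> closes (G `|` [set fsubst s A])) ->
    closes G.

(** Compactness: each rule has a finite antecedent and finitely many branches, so only finitely many
    formulas of [G] are ever inspected. Quantifying over [G'] yields monotonicity at once. *)
Lemma closes_finite (G : set fm) : closes G ->
  exists2 F : seq fm, [set` F] `<=` G &
    forall G' : set fm, [set` F] `<=` G' -> closes G'.
Proof.
elim=> {G} [G A GA PA|G x s xrs xG xL _ IH].
  exists [:: A]; first by move=> B /=; rewrite inE => /eqP ->.
  by move=> G' AG'; apply: (@closes_goal _ A) => //; apply: AG'; rewrite /= inE.
suff [F FG FP] : exists2 F : seq fm, [set` F] `<=` G &
    forall G' : set fm, [set` F] `<=` G' ->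
      forall A, A \in x.2 -> closes (G' `|` [set fsubst s A]).
  exists ([seq fsubst s A | A <- x.1] ++ F).
    move=> B /=; rewrite mem_cat => /orP[/mapP[A Ax ->]|]; first exact: xG.
    exact: FG.
  move=> G' sG'; apply: (closes_rule xrs _ xL) => [A Ax|A Ax].
    by apply: sG'; rewrite /= mem_cat map_f.
  by apply: FP => // B BF; apply: sG'; rewrite /= mem_cat; apply/orP; right.
elim: x.2 IH => [|B l IHl] IH; first by exists [::].
have [|F1 F1G F1P] := IHl; first by move=> A Al; apply: IH; rewrite inE Al orbT.
have [|F2 F2G F2P] := IH B; first exact: mem_head.
(* The formula added on the branch is removed from its finite support, since it need not lie in
   [G]. *)
exists ([seq C <- F2 | C != fsubst s B] ++ F1).
  move=> C /=; rewrite mem_cat => /orP[|]; last exact: F1G.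
  by rewrite mem_filter => /andP[/eqP CB /F2G[//|]].
move=> G' sG' A; rewrite inE => /predU1P[->|Al].
  apply: F2P => C CF2; have [->|CB] := eqVneq C (fsubst s B); first by right.
  by left; apply: sG'; rewrite /= mem_cat mem_filter CB; apply/orP; left.
by apply: F1P => // C CF; apply: sG'; rewrite /= mem_cat; apply/orP; right.
Qed.

Lemma closes_mono (G G' : set fm) : G `<=` G' -> closes G -> closes G'.
Proof. by move=> GG' /closes_finite[F FG]; apply; apply: subset_trans GG'. Qed.

Lemma closes_tree (G : set fm) : closes G -> G `<=` L ->
  exists t, [/\ derivation (calculus_of rs) t, root_label t = Some G,
    forall H, List.In (Some H) (leaf_labels t) -> H `&` Psi !=set0 &
    forall H, List.In (Some H) (labels t) -> H `<=` L].
Proof.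
elim=> {G} [G A GA PA|G x s xrs xG xL _ IH] GL.
  exists (Node (Some G) [::]); split => //=.
  - exact: deriv_leaf.
  - by move=> H [[<-]|//]; exists A.
  - by move=> H [[<-]|//].
have Rx : calculus_of rs (Rule [set` x.1] [set` x.2]) by exists x.
have xG' : fsubst s @` [set` x.1] `<=` G by move=> _ [A Ax <-]; apply: xG.
have [x0|[A0 A0x]] : x.2 = [::] \/ exists A, A \in x.2.
  by case: x.2 => [|A l]; [left|right; exists A; rewrite mem_head].
  exists (Node (Some G) [:: Node None [::]]); split => //=.
  - by apply: (deriv_star Rx xG'); rewrite /= x0; apply/seteqP; split.
  - by move=> H [|].
  - by move=> H [[<-]|[|]].
(* A substitution may identify succedent formulas, while [deriv_expand] wants one child per distinct
   instance. *)
pose e := undup [seq fsubst s A | A <- x.2].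
have eP B : B \in e -> exists t, [/\ derivation (calculus_of rs) t,
    root_label t = Some (G `|` [set B]),
    forall H, List.In (Some H) (leaf_labels t) -> H `&` Psi !=set0 &
    forall H, List.In (Some H) (labels t) -> H `<=` L].
  rewrite mem_undup => /mapP[A Ax ->]; apply: IH => // C [/GL//|->].
  exact: xL.
have [cs [csD csr csl csL]] : exists cs : seq dtree,
    [/\ forall c, List.In c cs -> derivation (calculus_of rs) c,
    map root_label cs = [seq Some (G `|` [set A]) | A <- e],
    forall H, List.In (Some H) (flatten (map leaf_labels cs)) ->
      H `&` Psi !=set0 &
    forall H, List.In (Some H) (flatten (map labels cs)) -> H `<=` L].
  elim: e eP => [|B l IHl] eP; first by exists [::].
  have [|cs [csD csr csl csL]] := IHl.
    by move=> C Cl; apply: eP; rewrite inE Cl orbT.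
  have [|t [tD tr tl tL]] := eP B; first exact: mem_head.
  exists (t :: cs); split => /=.
  - by move=> c [<-//|]; apply: csD.
  - by rewrite tr csr.
  - by move=> H /(List.in_app_or _ _ _)[/tl|/csl].
  - by move=> H /(List.in_app_or _ _ _)[/tL|/csL].
exists (Node (Some G) cs); split => //=.
- apply: (deriv_expand Rx xG' _ (undup_uniq _) _ csr csD).
  + by exists A0.
  + apply/seteqP; split => B /=.
      by rewrite mem_undup => /mapP[A Ax ->]; exists A.
    by move=> [A Ax <-]; rewrite mem_undup map_f.
(* [e] is inhabited, so [cs] is not empty and the new node is not itself a leaf. *)
- have : fsubst s A0 \in e by rewrite mem_undup map_f.
  by case: cs csr csl {csD csL} => [|//]; case: e {eP}.
- by move=> H [[<-]|/csL].
Qed.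

Lemma closes_derives_in (Phi : set fm) : Phi `<=` L -> closes Phi ->
  derives_in L (calculus_of rs) Phi Psi.
Proof.
move=> PL /closes_tree/(_ PL)[t [tD tr tl tL]].
by exists t => //; split => //; exists Phi.
Qed.

(** * Lindenbaum extension relative to [L] *)

Fixpoint lindenbaum_seq (Phi : set fm) (n : nat) : set fm :=
  if n is m.+1 then
    let G := lindenbaum_seq Phi m in
    (* At most one formula has code [m], so each stage adds at most one formula. *)
    G `|` [set A | [/\ pickle A = m, L A & ~ closes (G `|` [set A])]]
  else Phi.

Lemma lindenbaum (Phi : set fm) : Phi `<=` L -> ~ closes Phi ->
  exists Om : set fm, [/\ Phi `<=` Om, Om `<=` L, ~ closes Om &
    forall A, L A -> ~ Om A -> closes (Om `|` [set A])].
Proof.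
move=> PL nP; pose G := lindenbaum_seq Phi.
have GS n : G n `<=` G n.+1 by move=> A; left.
have Gmono m n : (m <= n)%N -> G m `<=` G n.
  elim: n => [|n IH]; first by rewrite leqn0 => /eqP ->.
  rewrite leq_eqVlt => /predU1P[->//|]; rewrite ltnS => /IH mn.
  exact: subset_trans (GS n).
have nG n : ~ closes (G n).
  elim: n => [//|n IH] cG.
  have [[A [An LA nA]]|nex] := pselect (exists A, [/\ pickle A = n, L A &
      ~ closes (G n `|` [set A])]).
    apply: nA; apply: closes_mono cG => B [|[Bn _ _]]; first by left.
    by right; apply: (pcan_inj pickleK); rewrite An.
  by apply: IH; apply: closes_mono cG => B [//|?]; case: nex; exists B.
exists (\bigcup_n G n); split.
- by move=> A PA; exists 0%N.
- move=> A [n _]; elim: n A => [|n IH] A; first exact: PL.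
  by case=> [/IH//|[]].
- move=> /closes_finite[F FG FP].
  (* By compactness a closing of the union would already close some stage. *)
  suff [n Fn] : exists n, [set` F] `<=` G n by apply: (nG n); apply: FP.
  elim: F FG {FP} => [|A F IH] FG; first by exists 0%N.
  have [|n Fn] := IH; first by move=> B BF; apply: FG; rewrite /= inE; apply/orP; right.
  have [|m _ Am] := FG A; first exact: mem_head.
  exists (maxn m n) => B /=; rewrite inE => /predU1P[->|BF].
    exact: (Gmono m) (leq_maxl _ _) _ Am.
  exact: (Gmono n) (leq_maxr _ _) _ (Fn _ BF).
- move=> A LA nA; apply: contrapT => ncA; apply: nA.
  exists (pickle A).+1 => //; right; split=> // cA; apply: ncA.
  by apply: closes_mono cA => B [BG|->]; [left; exists (pickle A)|right].
Qed.

End Closes.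

(** * Soundness *)

Definition desig (x : V6) : bool := V6_le v_b x.

Lemma desigE (x : V6) : up_b x = desig x :> Prop.
Proof. by []. Qed.

Definition subst2 (A B : fm) (n : nat) : fm := if n is 0 then A else B.

(** The rules contain only [p] and [q], so the values of [s 0] and [s 1] decide everything.
    Implications occur in them only as whole formulas, hence only their designation matters, and
    that is deterministic. *)
Lemma valuation_rules (h : fm -> M_A1) (s : nat -> fm) : valuation h ->
  all (fun x => all (fun A => desig (h (fsubst s A))) x.1 ==>
                has (fun A => desig (h (fsubst s A))) x.2)
      (PP6_rules ++ imp_A1_rules).
Proof.
move=> [hBot [hTop [hNeg [hCirc [hAnd [hOr hImp]]]]]].
have eBot : h Bot = v_fhat by [].
have eTop : h Top = v_that by [].
have eNeg A : h (Neg A) = V6_neg (h A) by exact: hNeg.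
have eCirc A : h (Circ A) = V6_circ (h A) by exact: hCirc.
have eAnd A B : h (And A B) = V6_meet (h A) (h B) by exact: hAnd.
have eOr A B : h (Or A B) = V6_join (h A) (h B) by exact: hOr.
have eImp A B : desig (h (Imp A B)) = ~~ desig (h A) || desig (h B).
  have := hImp A B; rewrite /= /V6_imp_A1 -!/(desig _).
  by case: ifP => _ // /negP/negbTE.
rewrite /= !eImp !(eBot, eTop, eNeg, eCirc, eAnd, eOr).
by case: (h (s 0%N)); case: (h (s 1%N)).
Qed.

(** If the root label is designated throughout, soundness of the rules selects at each node a child
    with the same property; the branch ends in a leaf that meets [Psi]. *)
Lemma derives_entails (Phi Psi : set fm) :
  derives R_A1 Phi Psi -> entails M_A1 Phi Psi.
Proof.
move=> [t [tD [G tG GPhi] tl]] h hV.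
have sound r s : R_A1 r ->
    (forall A, prem r A -> desig (h (fsubst s A))) ->
    exists2 A, concl r A & desig (h (fsubst s A)).
  move=> [x xR <-] /= hx; have /allP/(_ x xR)/implyP := valuation_rules s hV.
  by move=> /(_ (introT allP hx))/hasP[A]; exists A.
have [|nG] := pselect (exists2 A, G A & ~ desig (h A)).
  by move=> [A GA nA]; left; exists A => //; apply: GPhi.
suff [H HL Hd] : exists2 H, List.In (Some H) (leaf_labels t) &
    forall A, H A -> desig (h A).
  by right; have [A [HA PA]] := tl _ HL; exists A => //; apply: Hd.
have {nG} : forall A, G A -> desig (h A).
  by move=> A GA; apply/negPn/negP => nA; apply: nG; exists A => //; apply/negP.
elim: tD G tG {GPhi tl} => {t} [l|G r s Rr rG r0|G r s e cs Rr rG _ _ ee csr _ IH].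
- by move=> G /= -> Gd; exists G => //; left.
- move=> _ [<-] Gd; have [|A] := sound r s Rr; last by rewrite r0.
  by move=> A rA; apply/Gd/rG; exists A.
- move=> _ [<-] Gd; have [|A rA dA] := sound r s Rr.
    by move=> A rA; apply/Gd/rG; exists A.
  (* The children match [e] position by position, so the designated instance singles out a child. *)
  have [c cin cr] : exists2 c, List.In c cs &
      root_label c = Some (G `|` [set fsubst s A]).
    have : [set` e] (fsubst s A) by rewrite ee; exists A.
    rewrite /=.
    elim: e cs csr {ee IH} => [//|B e IHe] [//|c cs] /= [cB csr].
    rewrite inE => /predU1P[->|/(IHe _ csr)[d dcs dA']].
      by exists c => //; left.
    by exists d => //; right.
  have [|H Hl Hd] := IH c cin _ cr; first by move=> B [/Gd//|->].
  exists H => //=; case: cs cin {IH csr} => // c' cs cin.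
  elim: {c' cs}(c' :: cs) cin => //= d cs IHcs cin.
  by apply: List.in_or_app; case: cin => [->|/IHcs]; [left|right].
Qed.

(** * Completeness *)

(** Outside [S] the value is computed from the immediate subformulas; variables get an arbitrary
    value, and implications a fixed representative of the admissible set. *)
Fixpoint extend (S : set fm) (v : fm -> V6) (A : fm) : V6 :=
  if `[< S A >] then v A else
  match A with
  | Var _ | Bot => v_fhat
  | Top => v_that
  | Neg B => V6_neg (extend S v B)
  | Circ B => V6_circ (extend S v B)
  | And B C => V6_meet (extend S v B) (extend S v C)
  | Or B C => V6_join (extend S v B) (extend S v C)
  | Imp B C => if ~~ desig (extend S v B) || desig (extend S v C)
               then v_that else v_fhat
  end.

Lemma extend_in (S : set fm) (v : fm -> V6) (A : fm) :
  S A -> extend S v A = v A.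
Proof. by move=> SA; case: A SA => * /=; rewrite asboolT. Qed.

Lemma mem_subformulas (A : fm) : A \in subformulas A.
Proof. by case: A => * /=; rewrite mem_head. Qed.

Lemma subformulas_trans (A B C : fm) :
  A \in subformulas B -> B \in subformulas C -> A \in subformulas C.
Proof.
move=> AB; elim: C => [n|||C IH|C IH|C IHC D IHD|C IHC D IHD|C IHC D IHD] /=.
1,2,3: by rewrite inE => /eqP BE; rewrite BE in AB.
1,2: rewrite inE => /predU1P[BE|/IH H]; first by rewrite BE in AB.
1,2: by rewrite inE H orbT.
all: rewrite inE mem_cat => /predU1P[BE|]; first by rewrite BE in AB.
all: move=> /orP[/IHC|/IHD] H.
all: by rewrite inE mem_cat H ?orbT.
Qed.

Lemma sub_trans (G : set fm) (A B : fm) :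
  sub G B -> A \in subformulas B -> sub G A.
Proof. by move=> [C GC BC] AB; exists C => //; apply: subformulas_trans BC. Qed.

Lemma sub_self (G : set fm) (A : fm) : G A -> sub G A.
Proof. by move=> GA; exists A => //; apply: mem_subformulas. Qed.

(** A constant substitution is the witness because [Upsilon] asks that every variable be sent to a
    subformula. *)
Lemma Upsilon_neg (G : set fm) (A : fm) :
  sub G A -> Upsilon Xi_A1 G (Neg A).
Proof. by move=> GA; right; exists (fun=> A), (Neg p); split. Qed.

Lemma Upsilon_circ (G : set fm) (A : fm) :
  sub G A -> Upsilon Xi_A1 G (Circ A).
Proof. by move=> GA; right; exists (fun=> A), (Circ p); split. Qed.

(** * Truth values read off from three bits *)

Section BitsValue.
Variables (S : set fm) (l w : pred fm).
Hypothesis S_sub : forall A B, S B -> A \in subformulas B -> S A.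
Hypothesis S_l : forall A, S A -> [/\ l A, l (Neg A) & l (Circ A)].

(** Here [w] stands for membership in the maximal set and [l] for membership in the bound. Indices
    start at 0: index [i] is rule [i + 1] of the calculus, and 37 to 39 are the implication
    rules. *)
Hypothesis w_rules : forall i A B, (i < 40)%N ->
  let x := nth ([::], [::]) (PP6_rules ++ imp_A1_rules) i in
  let f := fsubst (subst2 A B) in
  all (fun C => l (f C)) x.2 ==> all (fun C => w (f C)) x.1 ==>
  has (fun C => w (f C)) x.2.

(* The combinations excluded by rules 24 and 25 are given junk values. *)
Definition bits_value (A : fm) : V6 :=
  match w (Circ A), w A, w (Neg A) with
  | true, true, _ => v_that
  | true, false, _ => v_fhat
  | false, true, true => v_b
  | false, true, false => v_t
  | false, false, false => v_n
  | false, false, true => v_f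
  end.

Lemma desig_bits_value (A : fm) : desig (bits_value A) = w A.
Proof. by rewrite /bits_value; do 3 case: (w _). Qed.

Lemma bits_value_bot : S Bot -> bits_value Bot = v_fhat.
Proof.
move=> /S_l[lA lN lC].
move: (@w_rules 3 Bot Bot isT) (@w_rules 18 Bot Bot isT).
rewrite /bits_value /= !(lA, lN, lC) /=.
by do 2 case: (w _).
Qed.

Lemma bits_value_top : S Top -> bits_value Top = v_that.
Proof.
move=> /S_l[lA lN lC].
move: (@w_rules 0 Top Top isT) (@w_rules 19 Top Top isT).
rewrite /bits_value /= !(lA, lN, lC) /=.
by do 2 case: (w _).
Qed.

Lemma bits_value_neg (A : fm) :
  S (Neg A) -> bits_value (Neg A) = V6_neg (bits_value A).
Proof.
move=> SN; have SA : S A by apply: S_sub SN _; rewrite inE mem_subformulas orbT.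
have [lA lN lC] := S_l SA; have [_ lNN lCN] := S_l SN.
move: (@w_rules 4 A A isT) (@w_rules 5 A A isT) (@w_rules 21 A A isT)
  (@w_rules 22 A A isT) (@w_rules 23 A A isT) (@w_rules 24 A A isT).
rewrite /bits_value /= !(lA, lN, lC, lNN, lCN) /=.
by case: (w (Circ A)); case: (w A); case: (w (Neg A));
   case: (w (Neg (Neg A))); case: (w (Circ (Neg A))).
Qed.

(** Rule 21 forces the bit of [Circ (Circ A)], which leaves only the two extreme values, chosen by
    [w (Circ A)]. *)
Lemma bits_value_circ (A : fm) :
  S (Circ A) -> bits_value (Circ A) = V6_circ (bits_value A).
Proof.
move=> SC; have SA : S A by apply: S_sub SC _; rewrite inE mem_subformulas orbT.
have [lA lN lC] := S_l SA; have [_ lNC lCC] := S_l SC.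
move: (@w_rules 20 A A isT).
rewrite /bits_value /= !(lA, lN, lC, lNC, lCC) /=.
by case: (w (Circ A)); case: (w A); case: (w (Neg A));
   case: (w (Neg (Circ A))); case: (w (Circ (Circ A))).
Qed.

(** Rules 24 and 25 exclude junk values for both conjuncts; rules 7 to 12 then govern the bits of
    the conjunction and its negation, rules 26 to 31 its [Circ] bit. *)
Lemma bits_value_and (A B : fm) :
  S (And A B) -> bits_value (And A B) = V6_meet (bits_value A) (bits_value B).
Proof.
move=> SAB.
have SA : S A by apply: S_sub SAB _; rewrite inE mem_cat mem_subformulas orbT.
have SB : S B by apply: S_sub SAB _; rewrite inE mem_cat mem_subformulas !orbT.
have [lA lNA lCA] := S_l SA; have [lB lNB lCB] := S_l SB.
have [lAB lNAB lCAB] := S_l SAB.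
move: (@w_rules 23 A A isT) (@w_rules 24 A A isT)
  (@w_rules 23 B B isT) (@w_rules 24 B B isT)
  (@w_rules 6 A B isT) (@w_rules 7 A B isT) (@w_rules 8 A B isT)
  (@w_rules 9 A B isT) (@w_rules 10 A B isT) (@w_rules 11 A B isT)
  (@w_rules 25 A B isT) (@w_rules 26 A B isT) (@w_rules 27 A B isT)
  (@w_rules 28 A B isT) (@w_rules 29 A B isT) (@w_rules 30 A B isT).
rewrite /bits_value /= !(lA, lNA, lCA, lB, lNB, lCB, lAB, lNAB, lCAB) /=.
by case: (w (Circ A)); case: (w A); case: (w (Neg A)) => //=;
   case: (w (Circ B)); case: (w B); case: (w (Neg B)) => //=;
   case: (w (Circ (And A B))); case: (w (And A B)); case: (w (Neg (And A B))).
Qed.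

Lemma bits_value_or (A B : fm) :
  S (Or A B) -> bits_value (Or A B) = V6_join (bits_value A) (bits_value B).
Proof.
move=> SAB.
have SA : S A by apply: S_sub SAB _; rewrite inE mem_cat mem_subformulas orbT.
have SB : S B by apply: S_sub SAB _; rewrite inE mem_cat mem_subformulas !orbT.
have [lA lNA lCA] := S_l SA; have [lB lNB lCB] := S_l SB.
have [lAB lNAB lCAB] := S_l SAB.
move: (@w_rules 23 A A isT) (@w_rules 24 A A isT)
  (@w_rules 23 B B isT) (@w_rules 24 B B isT)
  (@w_rules 12 A B isT) (@w_rules 13 A B isT) (@w_rules 14 A B isT)
  (@w_rules 15 A B isT) (@w_rules 16 A B isT) (@w_rules 17 A B isT)
  (@w_rules 31 A B isT) (@w_rules 32 A B isT) (@w_rules 33 A B isT)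
  (@w_rules 34 A B isT) (@w_rules 35 A B isT) (@w_rules 36 A B isT).
rewrite /bits_value /= !(lA, lNA, lCA, lB, lNB, lCB, lAB, lNAB, lCAB) /=.
by case: (w (Circ A)); case: (w A); case: (w (Neg A)) => //=;
   case: (w (Circ B)); case: (w B); case: (w (Neg B)) => //=;
   case: (w (Circ (Or A B))); case: (w (Or A B)); case: (w (Neg (Or A B))).
Qed.

(** Only designation is prescribed, which is all that the multioperation constrains. *)
Lemma bits_value_imp (A B : fm) : S (Imp A B) ->
  desig (bits_value (Imp A B)) =
    ~~ desig (bits_value A) || desig (bits_value B).
Proof.
move=> SAB.
have SA : S A by apply: S_sub SAB _; rewrite inE mem_cat mem_subformulas orbT.
have SB : S B by apply: S_sub SAB _; rewrite inE mem_cat mem_subformulas !orbT.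
have [lA _ _] := S_l SA; have [lB _ _] := S_l SB; have [lAB _ _] := S_l SAB.
move: (@w_rules 37 A B isT) (@w_rules 38 A B isT) (@w_rules 39 A B isT).
rewrite !desig_bits_value /= !(lA, lB, lAB) /=.
by case: (w A); case: (w B); case: (w (Imp A B)).
Qed.

Lemma valuation_extend :
  valuation (extend S bits_value : fm -> M_A1).
Proof.
do ![split] => /=.
- by case: asboolP => // /bits_value_bot.
- by case: asboolP => // /bits_value_top.
- move=> A; case: asboolP => // SN.
  have SA : S A by apply: S_sub SN _; rewrite inE mem_subformulas orbT.
  by rewrite bits_value_neg // extend_in.
- move=> A; case: asboolP => // SN.
  have SA : S A by apply: S_sub SN _; rewrite inE mem_subformulas orbT.
  by rewrite bits_value_circ // extend_in.
- move=> A B; case: asboolP => // SAB.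
  have SA : S A by apply: S_sub SAB _; rewrite inE mem_cat mem_subformulas orbT.
  have SB : S B by apply: S_sub SAB _; rewrite inE mem_cat mem_subformulas !orbT.
  by rewrite bits_value_and // !extend_in.
- move=> A B; case: asboolP => // SAB.
  have SA : S A by apply: S_sub SAB _; rewrite inE mem_cat mem_subformulas orbT.
  have SB : S B by apply: S_sub SAB _; rewrite inE mem_cat mem_subformulas !orbT.
  by rewrite bits_value_or // !extend_in.
- move=> A B; rewrite /V6_imp_A1 -!/(desig _).
  case: asboolP => [SAB|_]; last by case: ifP.
  have SA : S A by apply: S_sub SAB _; rewrite inE mem_cat mem_subformulas orbT.
  have SB : S B by apply: S_sub SAB _; rewrite inE mem_cat mem_subformulas !orbT.
  rewrite !(extend_in _ SA, extend_in _ SB) -(bits_value_imp SAB).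
  by case: ifPn => // /negP.
Qed.

End BitsValue.

(** * Completeness within the analyticity bound *)

Lemma entails_derives_in (Phi Psi : set fm) : entails M_A1 Phi Psi ->
  derives_in (Upsilon Xi_A1 (Phi `|` Psi)) R_A1 Phi Psi.
Proof.
set L := Upsilon _ _; set S := sub (Phi `|` Psi) => ent.
have SL A : S A -> L A by left.
have PS A : Phi A -> S A by move=> PA; apply: sub_self; left.
apply: (@closes_derives_in (PP6_rules ++ imp_A1_rules)).
  by move=> A /PS/SL.
apply: contrapT => nc.
have [Om [PO OL nO Omax]] := lindenbaum (fun A PA => SL A (PS A PA)) nc.
pose w A := `[< Om A >]; pose l A := `[< L A >].
have S_sub A B : S B -> A \in subformulas B -> S A by exact: sub_trans.
have S_l A : S A -> [/\ l A, l (Neg A) & l (Circ A)].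
  move=> SA; split; apply/asboolP.
  - exact: SL.
  - exact: Upsilon_neg.
  - exact: Upsilon_circ.
have w_rules i A B : (i < 40)%N ->
    let x := nth ([::], [::]) (PP6_rules ++ imp_A1_rules) i in
    let f := fsubst (subst2 A B) in
    all (fun C => l (f C)) x.2 ==> all (fun C => w (f C)) x.1 ==>
    has (fun C => w (f C)) x.2.
  move=> i40; cbv zeta; set x := nth _ _ _; apply/implyP => /allP xl; apply/implyP => /allP xw.
  (* If no succedent instance were in [Om], maximality would close every branch of the rule, and
     hence [Om]. *)
  apply/negPn/negP => /hasPn nw; apply: nO.
  apply: (@closes_rule _ _ _ _ x (subst2 A B)).
  - exact: mem_nth.
  - by move=> C /xw/asboolP.
  - by move=> C /xl/asboolP.
  - by move=> C Cx; apply: Omax; [apply/asboolP/xl|apply/asboolPn/nw].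
(* This valuation designates all of [Phi]; a designated formula of [Psi] would lie in [Om] and close
   it outright. *)
have [] := ent _ (valuation_extend S_sub S_l w_rules).
  move=> [A PA []] /=; rewrite desigE (extend_in _ (PS _ PA)) desig_bits_value.
  exact/asboolP/PO.
move=> [A PA] /=; rewrite desigE extend_in; last by apply: sub_self; right.
by rewrite desig_bits_value => /asboolP OA; apply: nO; apply: closes_goal PA.
Qed.

Theorem theorem4p4 :
  analytic Xi_A1 R_A1 /\
  (forall Phi Psi : set fm, derives R_A1 Phi Psi <-> entails M_A1 Phi Psi).
Proof.
(* Analyticity goes through the semantics: the given derivation is not transformed, but replaced by
   a bounded one obtained from completeness. *)
split=> [Phi Psi /derives_entails/entails_derives_in //|Phi Psi].
split=> [/derives_entails //|/entails_derives_in[t tP _]].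
by exists t.
Qed.
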